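(* Let $r=r(n)$ be a function of $n$ taking integer values $r(n)\ge 2$ and satisfying $r(n)=o\!\left(\frac{\ln n}{\ln\ln n}\right)$ as $n\to\infty$. For an integer $r\ge 2$ put $$q'(r)=\frac{(r!)^{1/r}}{2^{1/r}\left(1-\frac1r\right)^{\frac{r-1}{r}}\, r^{\frac{r-2}{r}}}.$$ Then for every $\varepsilon\in(0,1)$ there exists $n_0$ such that for every $n\ge n_0$, writing $r=r(n)$, $$m(n,r)\ \ge\ (1-\varepsilon)\,q'(r)\left(\frac{n}{\ln n}\right)^{\frac{r-1}{r}} r^{\,n-1}.$$ In particular, for fixed $r\ge2$ and any constant $q<q'(r)$, one has $m(n,r)\ge q\left(\frac{n}{\ln n}\right)^{\frac{r-1}{r}} r^{n-1}$ for all sufficiently large $n$.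
   Context: A hypergraph $H=(V,E)$ consists of a finite vertex set $V$ and a family $E$ of subsets of $V$ (edges); it is $n$-uniform if every edge has exactly $n$ vertices. A coloring of $V$ with $r$ colors is proper if no edge is monochromatic (all vertices of one color). The chromatic number of $H$ is the least $r$ for which a proper $r$-coloring exists. For integers $n\ge2$, $r\ge2$, $m(n,r)$ denotes the minimum number of edges of an $n$-uniform hypergraph whose chromatic number is greater than $r$. *)

(* Defs.v *)
From mathcomp Require Import all_boot.
From Stdlib Require Import Reals.
Set Implicit Arguments. Unset Strict Implicit. Unset Printing Implicit Defensive.

Definition uniform (n : nat) (V : finType) (E : {set {set V}}) : Prop :=
  forall e, e \in E -> #|e| = n.

Definition monochromatic (V : finType) (k : nat) (f : V -> 'I_k) (e : {set V}) : Prop :=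
  exists c : 'I_k, forall v, v \in e -> f v = c.

Definition proper_coloring (V : finType) (k : nat) (E : {set {set V}}) (f : V -> 'I_k) : Prop :=
  forall e, e \in E -> ~ monochromatic f e.

Definition colorable (k : nat) (V : finType) (E : {set {set V}}) : Prop :=
  exists f : V -> 'I_k, proper_coloring E f.

Definition m_ge (n r : nat) (x : R) : Prop :=
  forall (V : finType) (E : {set {set V}}),
    uniform n E -> ~ colorable r E -> (x <= INR #|E|)%R.

Local Open Scope R_scope.

Definition qprime (r : nat) : R :=
  Rpower (INR (r`!)%N) (1 / INR r) /
  (Rpower 2 (1 / INR r) *
   Rpower (1 - 1 / INR r) ((INR r - 1) / INR r) *
   Rpower (INR r) ((INR r - 2) / INR r)).

(* Main.v *)
Require Import Defs.
From mathcomp Require Import all_boot all_order all_algebra zify.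
From mathcomp Require Import boolp Rstruct.
Set Implicit Arguments. Unset Strict Implicit. Unset Printing Implicit Defensive.

(** Cut [0, 1] into long intervals Delta_0 < ... < Delta_(r-1) separated by short
gaps delta_0, ..., delta_(r-2) of length ln n / (r n), and place the vertices
independently and uniformly.  Vertices of Delta_j get colour j; a vertex x of
delta_j gets colour j + 1 if it is the last vertex of an edge which closes a chain,
and colour j otherwise.  If this colouring is not proper, then there are edges
A_0, ..., A_k, k < r, running from Delta_a to Delta_(a+k), such that the last vertex
of A_i is the first vertex of A_(i+1) and lies in delta_(a+i).  For given edges the
probability of such a chain is estimated by fixing the positions of the k linking
vertices: the other vertices fall independently into intervals whose lengths
telescope, and 1 + x <= exp x turns the product of lengths into the exponential of
their sum.  With |E| = lam r^(n-1) (n / ln n)^((r-1)/r), the expected number of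
chains of k + 1 edges is at most
(1 + o(1)) (r - k)/r lam^(k+1) (ln n)^(-(1 - (k+1)/r)).  The term k = r - 1 is at
most 1 - eps, since q'(r)^r = r r! / (2 (r-1)^(r-1)) <= r, and the other terms
are jointly o(1), uniformly in r, since q'(r)^r <= 10 (361/400)^r. *)

(** * A factorial inequality *)

Lemma bernoulli_nat (x m : nat) : (x ^ m.+1 + m.+1 * x ^ m <= x.+1 ^ m.+1)%N.
Proof.
elim: m => [|m IH]; first by rewrite !expn1 expn0; lia.
rewrite expnS [(x.+1 ^ _)%N]expnS.
apply: leq_trans (leq_mul (leqnn _) IH); rewrite [(x ^ m.+1)%N]expnS; nia.
Qed.

(** With r = m + 2 this is r! / (2 (r-1)^(r-1)) <= (3/4)^(r-2). In the induction step Bernoulli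
    gives 2 (m+1)^(m+1) <= (m+2)^(m+1), which leaves 4 (m+3) <= 6 (m+2). *)
Lemma fact_le_geometric (m : nat) :
  ((m.+2)`! * 4 ^ m <= 2 * m.+1 ^ m.+1 * 3 ^ m)%N.
Proof.
elim: m => [|m IH]; first by [].
have B : (2 * m.+1 ^ m.+1 <= m.+2 ^ m.+1)%N.
  by have := bernoulli_nat m.+1 m; rewrite -expnS; lia.
rewrite factS expnS [(3 ^ m.+1)%N]expnS [(m.+2 ^ m.+2)%N]expnS.
move: IH B; move: (m.+2)`! (4 ^ m)%N (3 ^ m)%N (m.+1 ^ m.+1)%N (m.+2 ^ m.+1)%N.
move=> f p q b c IH B.
have h1 : (m.+3 * 4 * (f * p) <= m.+3 * 4 * (2 * b * q))%N by rewrite leq_mul2l IH orbT.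
have h2 : (m.+3 * 4 * q * (2 * b) <= m.+3 * 4 * q * c)%N by rewrite leq_mul2l B orbT.
have h3 : (q * c * (m.+3 * 4) <= q * c * (6 * m.+2))%N by rewrite leq_mul2l; lia.
lia.
Qed.

(** * Chains of edges and the colouring *)

(** Ties between equal positions are broken by the enumeration of [V]. *)
Definition key (V : finType) (w : V -> nat) (v : V) : nat :=
  (w v * #|V| + enum_rank v)%N.

Lemma key_leW (V : finType) (w : V -> nat) u v :
  (key w u <= key w v)%N -> (w u <= w v)%N.
Proof.
rewrite /key => h; rewrite leqNgt; apply/negP => lt.
have hv : (enum_rank v < #|V|)%N by apply: ltn_ord.
have := leq_mul lt (leqnn #|V|); move: h hv; rewrite mulSn.
move: (nat_of_ord _) (nat_of_ord _) => i j; lia.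
Qed.

Lemma key_inj (V : finType) (w : V -> nat) : injective (key w).
Proof.
move=> u v e; have e1 : w u = w v.
  by apply/eqP; rewrite eqn_leq !(@key_leW _ w) // e.
apply: enum_rank_inj; apply: val_inj.
by move: e; rewrite /key e1 => /addnI.
Qed.

(** Positions are natural numbers: [j * M.+1] stands for the whole of Delta_j, and the
[M] numbers strictly between [j * M.+1] and [j.+1 * M.+1] discretize delta_j. *)
Definition in_gap (M j z : nat) : bool := (j * M.+1 < z < j.+1 * M.+1)%N.

(** The index [k] is the place of [B] in the chain: a later edge must begin at the preceding link,
    whereas the first one only has to avoid everything left of Delta_a. *)
Definition chain_low (V : finType) (w : V -> nat) (M a : nat) (B : {set V})
    (v : nat -> V) (k : nat) : Prop :=
  if k is k'.+1
  then v k' \in B /\ forall u, u \in B -> (key w (v k') <= key w u)%N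
  else forall u, u \in B -> (a * M.+1 <= w u)%N.

Definition chain_high (V : finType) (w : V -> nat) (M j : nat) (B : {set V})
    (x : V) : Prop :=
  [/\ in_gap M j (w x), x \in B & forall u, u \in B -> (key w u <= key w x)%N].

(** [A] and [v] are total on [nat] with irrelevant values from [k] on, so that extending a chain
    changes no types. *)
Definition chain_links (V : finType) (E : {set {set V}}) (w : V -> nat)
    (M a k : nat) (A : nat -> {set V}) (v : nat -> V) : Prop :=
  forall i, (i < k)%N ->
    [/\ A i \in E, chain_low w M a (A i) v i & chain_high w M (a + i) (A i) (v i)].

Definition closed_chain (V : finType) (E : {set {set V}}) (w : V -> nat)
    (M a k : nat) (A : nat -> {set V}) (v : nat -> V) : Prop :=
  [/\ chain_links E w M a k A v, A k \in E, chain_low w M a (A k) v k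
    & forall u, u \in A k -> (w u <= (a + k) * M.+1)%N].

Definition startable (V : finType) (E : {set {set V}}) (w : V -> nat)
    (M j : nat) (B : {set V}) : Prop :=
  exists a k A v,
    [/\ (a + k = j)%N, chain_links E w M a k A v & chain_low w M a B v k].

(** These are the vertices of delta_j that the colouring moves up to colour [j.+1]. *)
Definition reached (V : finType) (E : {set {set V}}) (w : V -> nat)
    (M j : nat) (x : V) : Prop :=
  exists2 B, B \in E & startable E w M j B /\ chain_high w M j B x.

Definition update (T : Type) (f : nat -> T) (k : nat) (x : T) (i : nat) : T :=
  if (i < k)%N then f i else x.

Lemma chain_low_update (V : finType) (w : V -> nat) M a (B : {set V}) (v : nat -> V) k x i :
  (i <= k)%N -> chain_low w M a B v i -> chain_low w M a B (update v k x) i.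
Proof. by case: i => [//|i] ik /=; rewrite /update ik. Qed.

Lemma startable_reached (V : finType) (E : {set {set V}}) (w : V -> nat) M j x (B : {set V}) :
  reached E w M j x -> x \in B ->
  (forall u, u \in B -> (key w x <= key w u)%N) -> startable E w M j.+1 B.
Proof.
case=> C CE [[a [k [A [v [ak links low]]]]] high] xB minx.
exists a, k.+1, (update A k C), (update v k x); split; first by lia.
- move=> i; rewrite ltnS leq_eqVlt => /predU1P[-> | ik].
    rewrite /update ltnn; split=> //; first exact: chain_low_update.
    by rewrite ak.
  have [AE lowi highi] := links _ ik.
  split; rewrite /update ik //.
  by apply: chain_low_update => //; apply: ltnW.
- by rewrite /= /update ltnn.
Qed.

(** Without closed chains the colouring [col] is proper: the first vertex of an edge of colour c
    shows that the edge can end a chain, and its last vertex shows that this chain closes or that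
    the vertex should have had colour c + 1. *)
Lemma exists_closed_chain (V : finType) (E : {set {set V}}) (w : V -> nat) r M :
  (0 < r)%N -> (forall u, (w u <= r.-1 * M.+1)%N) ->
  (forall B : {set V}, B \in E -> exists x, x \in B) -> ~ colorable r E ->
  exists a k A v, (a + k < r)%N /\ closed_chain E w M a k A v.
Proof.
move=> r0 wr Ene ncol; apply: contrapT => nobad; apply: ncol.
have nostart c (B : {set V}) : (c < r)%N -> B \in E -> startable E w M c B ->
    (forall u, u \in B -> (w u <= c * M.+1)%N) -> False.
  move=> cr BE [a [k [A [v [ak links low]]]]] wB; apply: nobad.
  exists a, k, (update A k B), v; rewrite ak; split=> //; split.
  - move=> i ik; have := links _ ik; by rewrite /update ik.
  - by rewrite /update ltnn.
  - by rewrite /update ltnn.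
  - by rewrite /update ltnn ak.
pose rb j x := `[< reached E w M j x >].
have rbP j x : reflect (reached E w M j x) (rb j x) by apply: asboolP.
pose col x : nat := let j := (w x %/ M.+1)%N in
  if in_gap M j (w x) && rb j x then j.+1 else j.
have div_le x : (w x %/ M.+1 * M.+1 <= w x < (w x %/ M.+1).+1 * M.+1)%N.
  by rewrite leq_divM ltn_ceil.
(* The last position is Delta_(r-1), so a gap delta_j has j < r - 1 and moving up stays below r. *)
have colr x : (col x < r)%N.
  rewrite /col; have := div_le x; have := wr x; rewrite /in_gap.
  set j := (_ %/ _)%N => h1 /andP[h2 h3].
  case: ifP => [/andP[/andP[h4 h5] _]|_]; nia.
have colP x c : col x = c ->
  [\/ w x = (c * M.+1)%N, in_gap M c (w x) /\ ~ reached E w M c x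
    | exists2 c', c = c'.+1 & in_gap M c' (w x) /\ reached E w M c' x].
  rewrite /col; have := div_le x; set j := (_ %/ _)%N => /andP[h2 h3].
  case: ifP => [/andP[h4 /rbP h5] <-|]; first by constructor 3; exists j.
  move=> /negbT; rewrite negb_and => /orP[h4 <-|h4 <-].
    by constructor 1; move: h4; rewrite /in_gap h3; lia.
  case: (boolP (in_gap M j (w x))) => h5; last first.
    by constructor 1; move: h5; rewrite /in_gap h3; lia.
  by constructor 2; split=> //; apply/rbP.
exists (fun x => Ordinal (colr x)) => B BE [c mono].
have [x0 x0B] := Ene _ BE.
have monoc x : x \in B -> col x = c by move=> /mono /(congr1 val).
have {mono} := monoc.
case: (arg_minnP (key w) x0B) => xm xmB minm.
case: (arg_maxnP (key w) x0B) => xM xMB maxM mono.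
(* If the first vertex lies in Delta_c or delta_c, then [B] alone starts a chain; if it lies in
   delta_(c-1), it was moved up, and [B] is appended to the chain that reached it. *)
have st : startable E w M c B.
  case: (colP _ _ (mono _ xmB)) => [e | [g _] | [c' -> [g rc]]].
  - exists c, 0%N, (fun _ => B), (fun _ => xm); split=> //; first by rewrite addn0.
    by move=> u uB; rewrite -e; apply: key_leW; apply: minm.
  - exists c, 0%N, (fun _ => B), (fun _ => xm); split=> //; first by rewrite addn0.
    move=> u uB; case/andP: g => g _; apply: leq_trans (ltnW g) _.
    by apply: key_leW; apply: minm.
  - by apply: startable_reached rc xmB _.
have cr : (c < r)%N by [].
case: (colP _ _ (mono _ xMB)) => [e | [g nr] | [c' e [g rc]]].
- apply: (nostart _ _ cr BE st) => u uB; rewrite -e.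
  by apply: key_leW; apply: maxM.
(* Here [B] itself reaches its last vertex, which should have been moved up. *)
- by apply: nr; exists B => //; split=> //; split.
- apply: (nostart _ _ cr BE st) => u uB.
  apply: leq_trans (key_leW (maxM u uB)) _.
  by case/andP: g => _ /ltnW; rewrite e.
Qed.

(** * The probability of a chain *)

Import Order.TTheory GRing.Theory Num.Theory.
Local Open Scope ring_scope.

Definition weight (K : realFieldType) (D eta : K) (M z : nat) : K :=
  if (M.+1 %| z)%N then D else eta.

Lemma weight_gap (K : realFieldType) (D eta : K) M j z :
  (j * M.+1 < z < j.+1 * M.+1)%N -> weight D eta M z = eta.
Proof.
by move=> h; rewrite /weight ifN //; apply/negP => /dvdnP[q e]; move: h;
rewrite e !ltn_pmul2r //; lia.
Qed.

Lemma weight_ge0 (K : realFieldType) (D eta : K) M z :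
  0 <= D -> 0 <= eta -> 0 <= weight D eta M z.
Proof. by rewrite /weight; case: ifP. Qed.

Lemma sum_weight_gap (K : realFieldType) (D eta : K) M j p q :
  (p <= q)%N -> (j * M.+1 < p)%N -> (q <= j.+1 * M.+1)%N ->
  \sum_(p <= z < q) weight D eta M z = (q - p)%:R * eta.
Proof.
move=> pq jp qj; rewrite (eq_big_nat _ _ (F2 := fun _ => eta)).
  by rewrite big_const_nat iter_addr_0 mulr_natl.
move=> z /andP[pz zq]; apply: (@weight_gap _ _ _ _ j); lia.
Qed.

Lemma weight_mul (K : realFieldType) (D eta : K) M j :
  weight D eta M (j * M.+1) = D.
Proof. by rewrite /weight dvdn_mull. Qed.

Lemma sum_weight_total (K : realFieldType) (D eta : K) M s :
  \sum_(z < (s * M.+1).+1) weight D eta M z = s.+1%:R * D + (s * M)%:R * eta.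
Proof.
rewrite -(big_mkord xpredT (fun z => weight D eta M z)).
elim: s => [|s IH].
  by rewrite !mul0n big_nat1 (weight_mul _ _ _ 0) mul0r addr0 mul1r.
rewrite big_nat_recr //= weight_mul (@big_cat_nat _ _ _ (s * M.+1).+1) //=; last lia.
rewrite IH (@sum_weight_gap _ _ _ _ s) //; last lia.
have -> : (s.+1 * M.+1 - (s * M.+1).+1)%N = M by lia.
rewrite mulSn natrD -[s.+2%:R]natr1 !mulrDl mul1r -!addrA; congr (_ + _).
by rewrite addrA addrC [_ + M%:R * eta]addrC.
Qed.

(** Of the q - p + 1 positions exactly one, [c * M.+1], stands for a Delta. *)
Lemma sum_weight_interval (K : realFieldType) (D eta : K) M N c p q :
  (p <= c * M.+1 <= q)%N -> (c * M.+1 < p + M.+1)%N -> (q < c.+1 * M.+1)%N ->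
  (q < N)%N ->
  \sum_(z < N | (p <= z <= q)%N) weight D eta M z = D + (q - p)%:R * eta.
Proof.
move=> /andP[pc cq] cp qc qN.
transitivity (\sum_(p <= z < q.+1) weight D eta M z).
  rewrite big_geq_mkord (big_ord_widen_cond N (fun i => (p <= i)%N)) //.
rewrite (@big_cat_nat _ _ _ (c * M.+1)) //=; last lia.
rewrite [X in _ + X]big_ltn; last lia.
rewrite weight_mul (@sum_weight_gap _ _ _ _ c (c * M.+1).+1) //.
have -> : \sum_(p <= z < c * M.+1) weight D eta M z = (c * M.+1 - p)%:R * eta.
  case: c cp cq pc {qc} => [|c] cp cq pc.
    by rewrite mul0n sub0n mul0r big_geq.
  by rewrite (@sum_weight_gap _ _ _ _ c) //; lia.
have -> : (q - p)%N = (c * M.+1 - p + (q.+1 - (c * M.+1).+1))%N by lia.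
by rewrite natrD mulrDl addrCA.
Qed.

(** A common vertex of A_i and A_j, i < j, comes no later than v_i and no earlier than v_(j-1).
    Since the gaps are ordered, j - 1 = i, and injectivity of [key] identifies the vertex. *)
Lemma chain_meet (V : finType) (E : {set {set V}}) (M a k : nat)
    (A : nat -> {set V}) (w : V -> nat) (v : nat -> V) : closed_chain E w M a k A v ->
  (forall i, (i < k)%N -> v i \in A i /\ v i \in A i.+1) /\
  (forall i j u, (i < j <= k)%N -> u \in A i -> u \in A j -> j = i.+1 /\ u = v i).
Proof.
case=> links Ak low _.
have lowi i : (i <= k)%N -> chain_low w M a (A i) v i.
  rewrite leq_eqVlt => /predU1P[->|ik] //; by have [] := links _ ik.
split=> [i ik|i j u /andP[ij jk] uAi uAj].
  have [_ _ [_ ? _]] := links _ ik; by have [] := lowi _ ik.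
case: j ij jk uAj => // j ij jk uAj.
have [_ _ [gi _ hi]] := links _ (@leq_ltn_trans j i k ij jk).
have [_ _ [gj _ _]] := links _ jk.
have [_ hj] := lowi _ jk.
have le1 := hi _ uAi; have le2 := hj _ uAj.
have := key_leW (leq_trans le2 le1); move/andP: gi => [g1 g2]; move/andP: gj => [g3 g4] h.
have eij : i = j by apply/eqP; rewrite eqn_leq -ltnS ij; nia.
split; first by rewrite eij.
by apply: (@key_inj _ w); apply/eqP; rewrite eqn_leq le1 eij le2.
Qed.

Lemma chain_link_inj (V : finType) (E : {set {set V}}) (M a k : nat)
    (A : nat -> {set V}) (w : V -> nat) (v : nat -> V) i j : closed_chain E w M a k A v ->
  (i < k)%N -> (j < k)%N -> v i = v j -> i = j.
Proof.
case=> links _ _ _ ik jk e.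
have [_ _ [/andP[g1 g2] _ _]] := links _ ik.
have [_ _ [/andP[g3 g4] _ _]] := links _ jk.
move: g1 g2 g3 g4; rewrite e; nia.
Qed.

Definition offset (k M : nat) (xi : {ffun 'I_k -> 'I_M}) (i : nat) : nat :=
  if insub i is Some j then xi j else 0%N.

(** Edge i of a chain lies between [cut i] and [cut i.+1]; the inner cuts are the positions of the
    links. The successor on [offset] skips the point that stands for the Delta itself. *)
Definition cut (k M a : nat) (xi : {ffun 'I_k -> 'I_M}) (i : nat) : nat :=
  if i is i'.+1 then
    if (i' < k)%N then ((a + i') * M.+1 + (offset xi i').+1)%N else ((a + k) * M.+1)%N
  else (a * M.+1)%N.

Lemma offset_ord (k M : nat) (xi : {ffun 'I_k -> 'I_M}) (i : 'I_k) :
  offset xi i = xi i.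
Proof. by rewrite /offset valK. Qed.

Lemma offset_lt (k M : nat) (xi : {ffun 'I_k -> 'I_M}) i :
  (i < k)%N -> (offset xi i < M)%N.
Proof. by move=> ik; rewrite (offset_ord xi (Ordinal ik)). Qed.

(** These are the conditions under which [sum_weight_interval] applies with c = a + i. *)
Lemma cut_bounds (k M a : nat) (xi : {ffun 'I_k -> 'I_M}) i : (i <= k)%N ->
  [/\ (cut a xi i <= (a + i) * M.+1 <= cut a xi i.+1)%N,
      ((a + i) * M.+1 < cut a xi i + M.+1)%N & (cut a xi i.+1 < (a + i).+1 * M.+1)%N].
Proof.
move=> ik; rewrite /cut; case: i ik => [|i] ik; [case: ifP => ik'|rewrite ik; case: ifP => ik'].
- have := offset_lt xi ik'; split; lia.
- have -> : k = 0%N by lia. split; lia.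
- have := offset_lt xi ik; have := offset_lt xi ik'; split; lia.
- have -> : i.+1 = k by lia. have := offset_lt xi ik; split; nia.
Qed.

Lemma prod_if_mem (K : comNzRingType) (V : finType) (B : {set V}) (y : K) :
  \prod_u (if u \in B then y else 1) = y ^+ #|B|.
Proof. by rewrite -big_mkcond prodr_const. Qed.

(** The [A i] may meet in the points [v j] only, so every factor [phi u] is charged to
one [y i], to one [eta], or to [1]. *)
Lemma prod_le_disjoint (K : realFieldType) (V I J : finType) (phi : V -> K)
    (A : I -> {set V}) (v : J -> V) (y : I -> K) (eta : K) :
  (forall u, 0 <= phi u <= 1) ->
  (forall i u, u \in A i -> phi u <= y i) ->
  (forall j, phi (v j) <= eta) ->
  (forall i j u, u \in A i -> u \in A j -> i != j -> exists l, u = v l) ->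
  injective v ->
  \prod_u phi u <=
  (\prod_i y i ^+ #|[set u in A i | [forall j, u != v j]]|) * eta ^+ #|J|.
Proof.
move=> phi01 phiy phie disj vinj.
pose I' i := [set u in A i | [forall j, u != v j]].
have -> : (\prod_i y i ^+ #|I' i|) * eta ^+ #|J| =
  \prod_u ((\prod_i (if u \in I' i then y i else 1)) *
           (\prod_j (if u == v j then eta else 1))).
  rewrite big_split /= exchange_big /=; congr (_ * _).
    by apply: eq_bigr => i _; rewrite prod_if_mem.
  rewrite exchange_big /= (eq_bigr (fun _ => eta)) ?prodr_const // => j _.
  by rewrite (bigD1 (v j)) //= eqxx big1 ?mulr1 // => u /negbTE ->.
apply: ler_prod => u _; have /andP[-> phi1] := phi01 u => /=.
case: (boolP [forall j, u != v j]) => [/forallP nv | ].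
  rewrite [X in _ * X]big1 ?mulr1; last by move=> j _; rewrite (negbTE (nv j)).
  case: (pickP (fun i => u \in A i)) => [i ui | nA]; last first.
    by rewrite big1 // => i _; rewrite inE nA.
  rewrite (bigD1 i) //= inE ui /= ifT; last exact/forallP.
  rewrite big1 ?mulr1; first exact: phiy.
  move=> j ji; rewrite inE; case: ifP => // /andP[uj _].
  have [l e] := disj _ _ _ ui uj (contra_neq (fun e => esym e) ji).
  by have := nv l; rewrite e eqxx.
rewrite negb_forall => /existsP[j]; rewrite negbK => /eqP ->.
rewrite big1 ?mul1r; last first.
  move=> i _; rewrite inE; case: ifP => // /andP[_ /forallP /(_ j)].
  by rewrite eqxx.
rewrite (bigD1 j) //= eqxx big1 ?mulr1 // => l lj.
by case: eqP => // /vinj e; rewrite e eqxx in lj.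
Qed.

Lemma cut_gap (k M a : nat) (xi : {ffun 'I_k -> 'I_M}) i : (i < k)%N ->
  ((a + i) * M.+1 < cut a xi i.+1 < (a + i).+1 * M.+1)%N.
Proof. by move=> ik; rewrite /cut ik; have := offset_lt xi ik; lia. Qed.

Lemma chain_positions (V : finType) (E : {set {set V}}) (M a k : nat)
    (A : nat -> {set V}) (w : V -> nat) (v : nat -> V) :
  closed_chain E w M a k A v ->
  exists xi : {ffun 'I_k -> 'I_M},
    (forall i, (i < k)%N -> w (v i) = cut a xi i.+1) /\
    (forall i u, (i <= k)%N -> u \in A i -> (cut a xi i <= w u <= cut a xi i.+1)%N).
Proof.
case=> links Ak low high.
have lowi i : (i <= k)%N -> chain_low w M a (A i) v i.
  rewrite leq_eqVlt => /predU1P[->|ik] //; by have [] := links _ ik.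
have ex (i : 'I_k) : exists m : 'I_M, w (v i) = ((a + i) * M.+1 + m.+1)%N.
  have [_ _ [/andP[g1 g2] _ _]] := links _ (ltn_ord i).
  have lt : (w (v i) - ((a + i) * M.+1).+1 < M)%N by lia.
  by exists (Ordinal lt) => /=; lia.
have [f fP] := fin_all_exists ex.
exists (finfun f).
have wv i : (i < k)%N -> w (v i) = cut a (finfun f) i.+1.
  move=> ik; rewrite /cut ik (offset_ord _ (Ordinal ik)) ffunE.
  exact: (fP (Ordinal ik)).
split=> // i u ik uA; apply/andP; split.
- case: i ik uA => [|i] ik uA; first exact: (lowi 0%N).
  rewrite -wv //; have [_ h] := lowi _ ik; exact: key_leW (h _ uA).
- move: ik; rewrite leq_eqVlt => /predU1P[e | ik].
    rewrite /cut e ltnn; apply: high; by rewrite -e.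
  rewrite -wv //; have [_ _ [_ _ h]] := links _ ik; exact: key_leW (h _ uA).
Qed.

(** An inner edge contains two links, an end edge of a longer chain one, and the only edge of a
    chain with k = 0 none. *)
Lemma card_interior (V : finType) (E : {set {set V}}) n (M a k : nat)
    (A : nat -> {set V}) (w : V -> nat) (v : nat -> V) (i : nat) :
  uniform n E -> (2 <= n)%N -> closed_chain E w M a k A v -> (i <= k)%N ->
  #|[set u in A i | [forall j : 'I_k, u != v j]]| =
    ((n - 2) + (i == 0) + (i == k))%N.
Proof.
move=> unif n2 ch ik; have [vA dis] := chain_meet ch.
have AE j : (j <= k)%N -> A j \in E.
  case: ch => links Ak _ _; rewrite leq_eqVlt => /predU1P[->|jk] //.
  by have [] := links _ jk.
have cA := unif _ (AE _ ik).
pose B := [set u in A i | (0 < i)%N && (u == v i.-1)].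
pose C := [set u in A i | (i < k)%N && (u == v i)].
have -> : [set u in A i | [forall j : 'I_k, u != v j]] = A i :\: (B :|: C).
  apply/setP => u; rewrite !inE andbC; case uA: (u \in A i) => /=; rewrite ?andbF ?andbT //.
  apply/forallP/idP => [nv | /norP[nB nC] j].
    rewrite negb_or !negb_and; apply/andP; split.
      case: i ik uA {cA B C} => // i ik uA; exact: (nv (Ordinal ik)).
    case: ltnP => //= ik'; exact: (nv (Ordinal ik')).
  apply/negP => /eqP e; have jk := ltn_ord j; have [vj vj1] := vA _ jk.
  case: (ltngtP i j) => ij.
  - rewrite e in uA; have := dis i j (v j); rewrite ij (ltnW jk) => /(_ isT uA vj) [e1 e2].
    have := @chain_link_inj _ _ _ _ _ _ _ _ i j ch; rewrite e2 => /(_ _ jk erefl).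
    lia.
  - case: (ltngtP i j.+1) => ij1; first lia.
      have := dis j.+1 i u; rewrite ij1 ik e => /(_ isT vj1); rewrite -e uA => /(_ isT) [e1 e2].
      have := dis j i u; rewrite ij ik e => /(_ isT vj); rewrite -e uA => /(_ isT) [e3 _]; lia.
    by move: nB; rewrite ij1 /= e eqxx.
  - by move: nC; rewrite ij jk e eqxx.
have cB : #|B| = (0 < i)%N.
  case: i @B {C} ik cA => [|i] B ik cA /=.
    by apply: eq_card0 => u; rewrite !inE andbF.
  rewrite -(cards1 (v i)); apply: eq_card => u; rewrite !inE /=.
  by rewrite andbC; case: eqP => // ->; have [_ ->] := vA _ ik.
have cC : #|C| = (i < k)%N.
  case: (ltnP i k) @C => ik' C /=; last by apply: eq_card0 => u; rewrite !inE andbF.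
  rewrite -(cards1 (v i)); apply: eq_card => u; rewrite !inE /=.
  by rewrite andbC; case: eqP => // ->; have [-> _] := vA _ ik'.
have BC : B :&: C = set0.
  apply/setP => u; rewrite !inE; apply/negP.
  move=> /andP[/andP[_ /andP[i0 /eqP e1]] /andP[_ /andP[i1 /eqP e2]]].
  have := @chain_link_inj _ _ _ _ _ _ _ _ i.-1 i ch; rewrite -e1 -e2.
  move=> /(_ _ i1 erefl); lia.
have sub : B :|: C \subset A i.
  by apply/subsetP => u; rewrite !inE => /orP[] /andP[].
rewrite cardsD (setIidPr sub) cardsU BC cards0 cA cB cC.
case: (ltngtP i k) ik => // ik _; case: i {B C cB cC BC sub cA} ik => [|i] //=; lia.
Qed.

Lemma sum_cut (k M a : nat) (xi : {ffun 'I_k -> 'I_M}) :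
  (\sum_(i < k.+1) (cut a xi i.+1 - cut a xi i) = k * M.+1)%N.
Proof.
rewrite -(big_mkord xpredT (fun i => cut a xi i.+1 - cut a xi i)%N).
rewrite telescope_sumn_in //; last first.
  move=> i /andP[_ ik]; have [/andP[h1 h2] _ _] := cut_bounds a xi ik; exact: leq_trans h1 h2.
by rewrite /cut ltnn; lia.
Qed.

(** [D + m%:R * eta] is the measure of an interval made of one Delta and [m] gap points;
bounding it by a geometric progression in [m] makes the product over the edges
depend on the endpoints of the chain only. *)
Lemma chain_probability_le (K : realFieldType) (V : finType) (E : {set {set V}})
    (n r M a k : nat) (D eta rho beta Y : K) (A : nat -> {set V}) :
  uniform n E -> (2 <= n)%N -> 0 <= D -> 0 <= eta ->
  r.+1%:R * D + (r * M)%:R * eta = 1 ->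
  (forall m : nat, D + m%:R * eta <= rho * beta ^+ m) -> D + M%:R * eta <= Y ->
  (a + k <= r)%N ->
  \sum_(w : {ffun V -> 'I_(r * M.+1).+1} |
        `[< exists v, closed_chain E (fun u => nat_of_ord (w u)) M a k A v >])
     \prod_u weight D eta M (w u) <=
  Y ^+ 2 * (M%:R * eta) ^+ k * (rho ^+ k.+1 * beta ^+ (k * M.+1)) ^+ (n - 2).
Proof.
move=> unif n2 D0 eta0 tot Hexp HY akr.
set X := (X in _ <= X).
have pos m : 0 <= D + m%:R * eta by rewrite addr_ge0 // mulr_ge0.
have Y0 : 0 <= Y by apply: le_trans HY; apply: pos.
have wge0 z : 0 <= weight D eta M z by apply: weight_ge0.
pose y (xi : {ffun 'I_k -> 'I_M}) (i : 'I_k.+1) : K :=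
  D + (cut a xi i.+1 - cut a xi i)%:R * eta.
(* There are M^k choices of [xi]; the multiple [*+ M ^ k] avoids a division when they are summed.
   The two extra factors, from the end edges, are bounded by [Y]. *)
have yX xi : (\prod_i y xi i ^+ ((n - 2) + (i == 0 :> nat) + (i == k :> nat))%N) *
   eta ^+ k *+ M ^ k <= X.
  have -> : \prod_i y xi i ^+ ((n - 2) + (i == 0 :> nat) + (i == k :> nat))%N =
      (\prod_i y xi i) ^+ (n - 2) * (y xi ord0 * y xi ord_max).
    under eq_bigr do rewrite !exprD.
    rewrite !big_split /= prodrXl -mulrA; congr (_ * (_ * _)).
      rewrite (bigD1 ord0) //= expr1 big1 ?mulr1 // => i /negbTE i0.
      by rewrite -(inj_eq val_inj) /= in i0; rewrite i0.
    rewrite (bigD1 ord_max) //= eqxx expr1 big1 ?mulr1 // => i /negbTE i0.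
    by rewrite -(inj_eq val_inj) /= in i0; rewrite i0.
  have yM i : (cut a xi i.+1 - cut a xi i <= M)%N -> D + (cut a xi i.+1 - cut a xi i)%:R * eta <= Y.
    move=> h; apply: le_trans HY; rewrite lerD2l ler_wpM2r // ler_nat //.
  have y0Y : y xi ord0 <= Y.
    apply: yM => /=; rewrite /cut; case: ifP => k0; last by have -> : k = 0%N; lia.
    have := offset_lt xi k0; lia.
  have y1Y : y xi ord_max <= Y.
    apply: yM; rewrite /= /cut ltnn; case: (k) (xi) => [|k'] xi'; first lia.
    rewrite leqnn; have := offset_lt xi' (leqnn k'.+1); lia.
  have prodle : \prod_i y xi i <= rho ^+ k.+1 * beta ^+ (k * M.+1).
    rewrite -(sum_cut a xi) -prodrXr.
    have -> : rho ^+ k.+1 = \prod_(i < k.+1) rho by rewrite prodr_const card_ord.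
    rewrite -big_split /=; apply: ler_prod => i _; rewrite pos /=; exact: Hexp.
  have prod0 : 0 <= \prod_i y xi i by apply: prodr_ge0 => i _; apply: pos.
  rewrite /X exprMn -mulr_natl natrX.
  rewrite [leLHS](_ : _ = (y xi ord0 * y xi ord_max) * (M%:R ^+ k * eta ^+ k) *
     (\prod_i y xi i) ^+ (n - 2)); last first.
    by rewrite [_ ^+ (n - 2) * _]mulrC mulrCA -!mulrA [_ ^+ (n - 2) * _]mulrC -mulrA.
  apply: ler_pM.
  - by apply: mulr_ge0; apply: mulr_ge0; rewrite ?exprn_ge0 //; apply: pos.
  - exact: exprn_ge0.
  - rewrite ler_wpM2r ?mulr_ge0 ?exprn_ge0 // expr2; apply: ler_pM => //; exact: pos.
  - by rewrite lerXn2r ?nnegrE // (le_trans prod0).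
have X0 : 0 <= X.
  apply: mulr_ge0; first by apply: mulr_ge0; apply: exprn_ge0; rewrite ?mulr_ge0.
  apply: exprn_ge0.
  (* The signs of [rho] and [beta] are extracted from [Hexp] at m = 0 and m = 1; if [rho] is 0, the
     whole factor vanishes. *)
  have rho0 : 0 <= rho by have := Hexp 0%N; rewrite mul0r addr0 mulr1; apply: (le_trans D0).
  have h := Hexp 1%N; rewrite expr1 in h.
  case: (ltP 0 rho) => rp.
    have b0 : 0 <= beta by rewrite -(pmulr_rge0 _ rp); apply: le_trans (pos 1%N) h.
    by rewrite mulr_ge0 ?exprn_ge0.
  have -> : rho = 0 by apply/le_anti; rewrite rp rho0.
  by rewrite exprS !mul0r lexx.
case: (pselect (exists w : {ffun V -> 'I_(r * M.+1).+1},
    exists v, closed_chain E (fun u => nat_of_ord (w u)) M a k A v)); last first.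
  by move=> none; rewrite big_pred0 // => w; apply/asboolP => h; apply: none; exists w.
move=> [w0 [v ch0]].
have [vA dis] := chain_meet ch0.
pose F (xi : {ffun 'I_k -> 'I_M}) (u : V) (z : 'I_(r * M.+1).+1) : bool :=
  [forall i : 'I_k.+1, (u \in A i) ==> (cut a xi i <= z <= cut a xi i.+1)%N] &&
  [forall i : 'I_k, (u == v i) ==> (z == cut a xi i.+1 :> nat)].
(* The links depend on [A] only: [v i] is the sole common vertex of [A i] and [A i.+1]. Hence the
   links found for [w0] serve every [w]. *)
have badF (w : {ffun V -> 'I_(r * M.+1).+1}) :
    (exists v, closed_chain E (fun u => nat_of_ord (w u)) M a k A v) ->
    exists xi, w \in family (F xi).
  move=> [v' ch']; have [xi [wv wA]] := chain_positions ch'; exists xi.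
  have [vA' _] := chain_meet ch'.
  apply/familyP => u; rewrite unfold_in /F; apply/andP; split.
    by apply/forallP => i; apply/implyP; apply: wA; rewrite -ltnS.
  apply/forallP => i; apply/implyP => /eqP ->; apply/eqP.
  have ik := ltn_ord i; rewrite -wv //; have [h1 h2] := vA' _ ik.
  by have [|_ ->] := dis i i.+1 (v' i) _ h1 h2; rewrite ?ltnSn ?eqxx.
have prodw0 (w : {ffun V -> 'I_(r * M.+1).+1}) : 0 <= \prod_u weight D eta M (w u).
  by apply: prodr_ge0 => u _.
apply: (@le_trans _ _ (\sum_(xi : {ffun 'I_k -> 'I_M})
   \sum_(w in family (F xi)) \prod_u weight D eta M (w u))).
  under [leRHS]eq_bigr do rewrite big_mkcond /=.
  rewrite exchange_big [leLHS]big_mkcond /=; apply: ler_sum => w _.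
  have ge0 xi : 0 <= if w \in family (F xi) then \prod_u weight D eta M (w u) else 0.
    by case: ifP.
  case: asboolP => [/badF [xi wxi] | _]; last exact: sumr_ge0.
  by rewrite (bigD1 xi) //= wxi lerDl sumr_ge0.
have termle xi : \sum_(w in family (F xi)) \prod_u weight D eta M (w u) <=
   (\prod_i y xi i ^+ ((n - 2) + (i == 0 :> nat) + (i == k :> nat))%N) * eta ^+ k.
  (* Independence: for fixed [xi] the constraints on different vertices are separate, so the sum
     over placements is a product over vertices. *)
  rewrite -(bigA_distr_big_dep _ (fun u z => weight D eta M (nat_of_ord z))).
  have -> : \prod_i y xi i ^+ ((n - 2) + (i == 0 :> nat) + (i == k :> nat))%N =
     \prod_i y xi i ^+ #|[set u in A i | [forall j : 'I_k, u != v j]]|.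
    by apply: eq_bigr => i _; rewrite (card_interior unif n2 ch0) // -ltnS.
  rewrite -[in eta ^+ k](card_ord k).
  apply: (@prod_le_disjoint _ _ _ _ _ (fun i : 'I_k.+1 => A i) (fun j : 'I_k => v j)).
  - move=> u; rewrite sumr_ge0 //=.
    apply: le_trans (_ : \sum_(z < (r * M.+1).+1) weight D eta M z <= 1).
      by rewrite [leLHS]big_mkcond /=; apply: ler_sum => z _; case: ifP.
    by rewrite sum_weight_total tot.
  - move=> i u uA; have ik : (i <= k)%N by rewrite -ltnS.
    have [h1 h2 h3] := cut_bounds a xi ik.
    rewrite /y -(@sum_weight_interval _ _ _ M (r * M.+1).+1 (a + i) _ _ h1 h2 h3).
      rewrite big_mkcond [leRHS]big_mkcond /=; apply: ler_sum => z _.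
      rewrite ?unfold_in /F; case: ifP => [/andP[/forallP /(_ i)]|_]; last by case: ifP.
      by rewrite uA /= => ->.
    move: h3; have : (a + i <= r)%N by lia.
    rewrite /cut; case: ifP => ik' h _; last by rewrite ltnS leq_mul2r akr orbT.
    have := offset_lt xi ik'; have : (a + i < r)%N by lia.
    move=> h4 h5; have : ((a + i).+1 * M.+1 <= r * M.+1)%N by rewrite leq_mul2r h4 orbT.
    lia.
  - move=> j; have jk := ltn_ord j.
    apply: (@le_trans _ _ (\sum_(z < (r * M.+1).+1 | z == cut a xi j.+1 :> nat) weight D eta M z)).
      rewrite big_mkcond [leRHS]big_mkcond /=; apply: ler_sum => z _.
      rewrite ?unfold_in /F; case: ifP => [/andP[_ /forallP /(_ j)]|_]; last by case: ifP.
      by rewrite eqxx /= => ->.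
    case: (ltnP (cut a xi j.+1) (r * M.+1).+1) => h.
      rewrite (big_pred1 (Ordinal h)); last by move=> z; rewrite /= -val_eqE.
      by rewrite (weight_gap _ _ (cut_gap a xi jk)).
    rewrite big_pred0 // => z; apply/eqP => e; have := ltn_ord z; rewrite e; lia.
  - move=> i j u ui uj ij.
    wlog lt : i j ui uj ij / (i < j)%N.
      move=> H; case: (ltngtP i j) => h; [exact: (H i j) | |].
        by apply: (H j i) => //; rewrite eq_sym.
      by rewrite (val_inj h) eqxx in ij.
    have jk : (j <= k)%N by rewrite -ltnS.
    have [|e1 e2] := dis i j u _ ui uj; first by rewrite lt.
    have ik : (i < k)%N by lia.
    by exists (Ordinal ik).
  - by move=> i j /(chain_link_inj ch0 (ltn_ord i) (ltn_ord j)) /val_inj.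
case: (posnP (M ^ k)%N) => [M0 | Mpos].
  rewrite big_pred0 // => xi; exfalso.
  have : (0 < #|{ffun 'I_k -> 'I_M}|)%N by apply/card_gt0P; exists xi.
  by rewrite card_ffun !card_ord M0.
apply: le_trans (ler_sum _ (fun xi _ => termle xi)) _.
rewrite -(ler_pMn2r Mpos) -sumrMnl.
apply: le_trans (ler_sum _ (fun xi _ => yX xi)) _.
by rewrite sumr_const card_ffun !card_ord.
Qed.

(** * The union bound over chains *)

Lemma closed_chain_eq (V : finType) (E : {set {set V}}) (w : V -> nat) (M a k : nat)
    (A B : nat -> {set V}) (v : nat -> V) :
  (forall i, (i <= k)%N -> A i = B i) ->
  closed_chain E w M a k A v -> closed_chain E w M a k B v.
Proof.
move=> AB [links Ak low high]; split; rewrite -?AB //.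
by move=> i ik; rewrite -AB ?(ltnW ik) //; apply: links.
Qed.

(** The placements have total mass 1 and each contains a closed chain. A chain of k + 1 edges has
    [r.+1 - k] possible values of [a] and at most [#|E| ^ k.+1] sequences of edges. *)
Lemma chain_union_bound (K : realFieldType) (V : finType) (E : {set {set V}})
    (n r M : nat) (D eta rho beta Y : K) :
  uniform n E -> (2 <= n)%N -> 0 <= D -> 0 <= eta ->
  r.+1%:R * D + (r * M)%:R * eta = 1 ->
  (forall m : nat, D + m%:R * eta <= rho * beta ^+ m) -> D + M%:R * eta <= Y ->
  ~ colorable r.+1 E ->
  1 <= \sum_(k < r.+1) (r.+1 - k)%:R * #|E|%:R ^+ k.+1 *
         (Y ^+ 2 * (M%:R * eta) ^+ k * (rho ^+ k.+1 * beta ^+ (k * M.+1)) ^+ (n - 2)).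
Proof.
move=> unif n2 D0 eta0 tot Hexp HY ncol.
have wge0 z : 0 <= weight D eta M z by apply: weight_ge0.
have prodw0 (w : {ffun V -> 'I_(r * M.+1).+1}) : 0 <= \prod_u weight D eta M (w u).
  by apply: prodr_ge0 => u _.
pose bad (w : {ffun V -> 'I_(r * M.+1).+1}) a k (A : nat -> {set V}) : bool :=
  `[< exists v, closed_chain E (fun u => nat_of_ord (w u)) M a k A v >].
rewrite [leLHS](_ : 1 = \sum_(w : {ffun V -> 'I_(r * M.+1).+1}) \prod_u weight D eta M (w u));
  last first.
  rewrite -(bigA_distr_bigA (fun u z => weight D eta M (nat_of_ord z))).
  by rewrite big1 // => u _; rewrite sum_weight_total tot.
apply: (@le_trans _ _ (\sum_(w : {ffun V -> 'I_(r * M.+1).+1}) \sum_(k < r.+1)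
  \sum_(a < r.+1 - k) \sum_(A : {ffun 'I_k.+1 -> {set V}} | A \in ffun_on (mem E))
    if bad w a k (fun i => A (inord i)) then \prod_u weight D eta M (w u) else 0)).
  apply: ler_sum => w _.
  have ite0 (b : bool) : 0 <= if b then \prod_u weight D eta M (w u) else 0.
    by case: b.
  have [||a [k [A [v [akr ch]]]]] := @exists_closed_chain V E (fun u => nat_of_ord (w u)) r.+1 M
    isT _ _ ncol.
  - by move=> u; rewrite -ltnS; apply: ltn_ord.
  - by move=> B /unif cB; apply/set0Pn; rewrite -card_gt0 cB; lia.
  have kr : (k < r.+1)%N by lia.
  have ak : (a < r.+1 - Ordinal kr)%N by rewrite /=; lia.
  pose A' : {ffun 'I_k.+1 -> {set V}} := [ffun i : 'I_k.+1 => A i].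
  have AA' i : (i <= k)%N -> A i = A' (inord i) by move=> ik; rewrite ffunE inordK.
  have A'E : A' \in ffun_on (mem E).
    apply/ffun_onP => i; rewrite ffunE; have := ltn_ord i; rewrite ltnS.
    case: ch => links Ak _ _; rewrite leq_eqVlt => /predU1P[->|ik] //.
    by have [] := links _ ik.
  rewrite (bigD1 (Ordinal kr)) //= (bigD1 (Ordinal ak)) //= (bigD1 A') //=.
  rewrite ifT; last by apply/asboolP; exists v; apply: closed_chain_eq ch.
  rewrite -!addrA lerDl addr_ge0 ?sumr_ge0 // addr_ge0 ?sumr_ge0 //.
    by move=> i _; apply: sumr_ge0.
  by move=> i _; apply: sumr_ge0 => j _; apply: sumr_ge0.
rewrite exchange_big /=; apply: ler_sum => k _.
rewrite exchange_big /= -mulrA mulr_natl -[X in _ *+ X]card_ord -sumr_const.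
apply: ler_sum => a _.
rewrite exchange_big /= -natrX mulr_natl.
have -> : (#|E| ^ k.+1)%N = #|[pred A : {ffun 'I_k.+1 -> {set V}} | A \in ffun_on (mem E)]|.
  by rewrite -[in LHS](card_ord k.+1) -card_ffun_on.
rewrite -sumr_const; apply: ler_sum => A _.
rewrite -big_mkcond /=; apply: chain_probability_le HY _ => //.
have := ltn_ord a; have := ltn_ord k; lia.
Qed.

Lemma sum_geometric_last_le (K : realFieldType) (F : nat -> K) (m : nat) (c d t : K) :
  0 <= c -> 0 <= t < 1 -> (forall k, (k < m)%N -> F k <= c * t ^+ k) -> F m <= d ->
  \sum_(k < m.+1) F k <= c / (1 - t) + d.
Proof.
move=> c0 /andP[t0 t1] HF Fm; rewrite big_ord_recr /=; apply: lerD => //.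
have t1' : 0 < 1 - t by rewrite subr_gt0.
apply: le_trans (_ : c * \sum_(k < m) t ^+ k <= _).
  by rewrite mulr_sumr; apply: ler_sum => k _; apply: HF.
apply: ler_wpM2l => //; rewrite -[X in _ <= X]mul1r ler_pdivlMr //.
have -> : (\sum_(k < m) t ^+ k) * (1 - t) = 1 - t ^+ m.
  by rewrite -opprB mulrN mulrC -subrX1 opprB.
by rewrite gerBl exprn_ge0.
Qed.

Close Scope ring_scope.

(** * Estimates over the reals *)

From Stdlib Require Import Reals Lra Lia Ring Field.
Local Open Scope R_scope.

Lemma exp_pow_INR (x : R) (n : nat) : exp x ^ n = exp (INR n * x).
Proof.
elim: n => [|n IH]; first by rewrite Rmult_0_l exp_0.
by rewrite S_INR /= IH -exp_plus; congr exp; ring.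
Qed.

Lemma exp_nondecreasing (x y : R) : x <= y -> exp x <= exp y.
Proof. by case=> [/exp_increasing /Rlt_le | ->] //; apply: Rle_refl. Qed.

Lemma INRM (m n : nat) : INR (m * n)%nat = INR m * INR n.
Proof. by rewrite -mult_INR. Qed.

Lemma INRB (m n : nat) : (n <= m)%nat -> INR (m - n)%nat = INR m - INR n.
Proof. by move=> h; rewrite -minus_INR //; apply/ssrnat.leP. Qed.

Lemma INR_leq (m n : nat) : (m <= n)%nat -> INR m <= INR n.
Proof. by move=> /ssrnat.leP; apply: le_INR. Qed.

(** Meant for L = ln n and l = ln ln n. Put u = L / n and s = 1 - (k+1)/r. The main terms s L and -
    n u s cancel. The error 5 u consists of 2 u from the end edges, 2 u s from n - 2 in place of n,
    and u from the discretization, for which M = n r is fine enough. *)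
Lemma chain_exponent_le (n r k M L l eta : R) :
  2 <= n -> 2 <= r -> 0 <= k <= r - 1 -> 0 <= L -> M = n * r ->
  eta * (M + 1) = L / n / r ->
  (k + 1) * ((1 - 1 / r) * (L - l)) + 2 * (L / n) + k * (l - L) +
   (n - 2) * ((k + 1) * (- ((r - 1) * M * eta)) + k * (M + 1) * (r * eta)) <=
  5 * (L / n) - l * ((r - (k + 1)) / r).
Proof.
move=> n2 r2 [k0 kr] L0 eM eeta.
set u := L / n in eeta *.
have u0 : 0 <= u by apply: Rle_mult_inv_pos; lra.
have eL : L = n * u by rewrite /u; field; lra.
have Mpos : 0 < M + 1 by rewrite eM; nra.
have eta0 : 0 <= eta.
  apply: (Rmult_le_reg_r (M + 1)) => //; rewrite Rmult_0_l eeta.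
  by apply: Rle_mult_inv_pos; lra.
set s := (r - (k + 1)) / r.
have s01 : 0 <= s <= 1.
  split; first by apply: Rle_mult_inv_pos; lra.
  by apply: (Rmult_le_reg_r r); rewrite /s; [lra | field_simplify; lra].
have small : n * ((k + 1) * (r - 1) * eta) <= u.
  have e : r * (eta * (M + 1)) = u by rewrite eeta; field; lra.
  have h : (k + 1) * (r - 1) <= r * r by nra.
  have : n * (k + 1) * (r - 1) <= r * (M + 1) by rewrite eM; nra.
  by move=> h2; nra.
have -> : (k + 1) * (- ((r - 1) * M * eta)) + k * (M + 1) * (r * eta) =
   - (u * s) + (k + 1) * (r - 1) * eta.
  have -> : (k + 1) * - ((r - 1) * M * eta) = (k + 1) * - ((r - 1) * (u / r - eta)).
    by have -> : u / r - eta = M * eta; [lra | ring].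
  have -> : k * (M + 1) * (r * eta) = k * r * (u / r) by rewrite -eeta; ring.
  by rewrite /s; field; lra.
have -> : (k + 1) * ((1 - 1 / r) * (L - l)) + 2 * u + k * (l - L) =
   s * (L - l) + 2 * u by rewrite /s; field; lra.
set e := (k + 1) * (r - 1) * eta in small *.
have e0 : 0 <= e by rewrite /e; apply: Rmult_le_pos => //; nra.
have : (n - 2) * e <= u by nra.
have : 2 * u * s <= 2 * u by nra.
rewrite eL; nra.
Qed.

(** The powers of r cancel up to one factor 1 / r, as (k+1)(n-1) - 2 - k - (k+1)(n-2) = -1; the
    exponentials are collected by [chain_exponent_le]. *)
Lemma chain_term_le (n r k M : nat) (L l lam eta D : R) :
  (2 <= n)%nat -> (2 <= r)%nat -> (k < r)%nat -> 0 <= lam -> 0 <= L ->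
  L = exp l -> INR n = exp L -> M = (n * r)%nat ->
  eta * (INR M + 1) = L / INR n / INR r ->
  INR r * D + INR (r - 1) * INR M * eta = 1 ->
  INR (r - k) * (lam * INR r ^ (n - 1) * exp ((1 - 1 / INR r) * (L - l))) ^ k.+1 *
   ((exp (L / INR n) / INR r) ^ 2 * (INR M * eta) ^ k *
    ((exp (INR r * D - 1) / INR r) ^ k.+1 * exp (INR r * eta) ^ (k * M.+1)) ^ (n - 2)) <=
  exp (5 * (L / INR n)) *
   (INR (r - k) / INR r * lam ^ k.+1 * exp (- (l * (INR (r - k.+1) / INR r)))).
Proof.
move=> n2 r2 kr lam0 L0 eL en eM eeta eD.
have nR : 2 <= INR n by have := INR_leq n2; rewrite /=; lra.
have rR : 2 <= INR r by have := INR_leq r2; rewrite /=; lra.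
have kR : 0 <= INR k <= INR r - 1.
  split; first exact: pos_INR.
  by have := INR_leq kr; rewrite S_INR; lra.
have MR : INR M = INR n * INR r by rewrite eM INRM.
have Mpos : 0 < INR M + 1 by rewrite MR; nra.
have eta0 : 0 <= eta.
  apply: (Rmult_le_reg_r (INR M + 1)) => //; rewrite Rmult_0_l eeta.
  by apply: Rle_mult_inv_pos; [apply: Rle_mult_inv_pos|]; lra.
have Mdeta : INR M * eta <= exp (l - L) / INR r.
  have -> : exp (l - L) = L / INR n.
    by rewrite exp_plus exp_Ropp -eL -en.
  lra.
have Meta0 : 0 <= INR M * eta by apply: Rmult_le_pos => //; apply: pos_INR.
have rk0 : 0 <= INR (r - k) by apply: pos_INR.
have P1 : 0 <= (exp (L / INR n) / INR r) ^ 2.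
  by apply: pow_le; apply: Rle_mult_inv_pos; [apply: Rlt_le; apply: exp_pos | lra].
have P2 : 0 <= ((exp (INR r * D - 1) / INR r) ^ k.+1 * exp (INR r * eta) ^ (k * M.+1)) ^ (n - 2).
  apply: pow_le; apply: Rmult_le_pos; apply: pow_le.
    by apply: Rle_mult_inv_pos; [apply: Rlt_le; apply: exp_pos | lra].
  by apply: Rlt_le; apply: exp_pos.
have P3 : 0 <= (lam * INR r ^ (n - 1) * exp ((1 - 1 / INR r) * (L - l))) ^ k.+1.
  apply: pow_le; apply: Rmult_le_pos; last by apply: Rlt_le; apply: exp_pos.
  by apply: Rmult_le_pos => //; apply: pow_le; lra.
have step : (INR M * eta) ^ k <= (exp (l - L) / INR r) ^ k by apply: pow_incr.
apply: (Rle_trans _ (INR (r - k) *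
   (lam * INR r ^ (n - 1) * exp ((1 - 1 / INR r) * (L - l))) ^ k.+1 *
   ((exp (L / INR n) / INR r) ^ 2 * (exp (l - L) / INR r) ^ k *
    ((exp (INR r * D - 1) / INR r) ^ k.+1 * exp (INR r * eta) ^ (k * M.+1)) ^ (n - 2)))).
  apply: Rmult_le_compat_l; first exact: Rmult_le_pos.
  apply: Rmult_le_compat_r => //; exact: Rmult_le_compat_l.
have -> : INR r * D - 1 = - ((INR r - 1) * INR M * eta).
  by move: eD; rewrite INRB /=; [lra | lia].
have := @chain_exponent_le (INR n) (INR r) (INR k) (INR M) L l eta nR rR kR L0 MR eeta.
set T := (X in X <= _); move=> hT.
have r0 : INR r <> 0 by lra.
set E1 := exp ((1 - 1 / INR r) * (L - l)).
set E2 := exp (L / INR n).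
set E3 := exp (l - L).
set E4 := exp (- ((INR r - 1) * INR M * eta)).
set E5 := exp (INR r * eta).
have eT : E1 ^ k.+1 * E2 ^ 2 * E3 ^ k * (E4 ^ k.+1 * E5 ^ (k * M.+1)) ^ (n - 2) = exp T.
  rewrite Rpow_mult_distr -!pow_mult !exp_pow_INR -!exp_plus; congr exp.
  rewrite /T !mult_INR -minusE -[(_ - _)%coq_nat]/(n - 2)%nat.
  rewrite (INRB n2) !S_INR  /=; ring.
have -> : INR (r - k) * (lam * INR r ^ (n - 1) * E1) ^ k.+1 *
   ((E2 / INR r) ^ 2 * (E3 / INR r) ^ k *
    ((E4 / INR r) ^ k.+1 * E5 ^ (k * M.+1)) ^ (n - 2)) =
   INR (r - k) / INR r * lam ^ k.+1 * exp T.
  rewrite -eT; case: (n) n2 => [|[|m]] // _.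
  have -> : (m.+2 - 1 = m.+1)%nat by lia.
  have -> : (m.+2 - 2 = m)%nat by lia.
  rewrite /Rdiv !Rpow_mult_distr -!pow_mult !pow_inv.
  have -> : INR r ^ (m * k.+1)%coq_nat = INR r ^ m * INR r ^ (k * m)%coq_nat.
    by rewrite -pow_add; congr pow; lia.
  rewrite -[INR r ^ k.+1]/(INR r * INR r ^ k).

  by field; repeat split => //; apply: pow_nonzero.
rewrite (Rmult_comm (exp (5 * _))) [X in _ <= X]Rmult_assoc -exp_plus.
apply: Rmult_le_compat_l.
  by apply: Rmult_le_pos; [apply: Rle_mult_inv_pos; lra | apply: pow_le].
apply: exp_nondecreasing; apply: Rle_trans hT _.
by rewrite (INRB kr) S_INR; lra.
Qed.

(** * The constant [qprime] and the size of the terms *)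

Lemma INRX (m n : nat) : INR (expn m n) = INR m ^ n.
Proof. by elim: n => [|n IH]; rewrite ?expnS ?INRM ?IH. Qed.

Lemma fact_ratio_le (r : nat) : (2 <= r)%nat ->
  INR (r`!)%nat / (2 * (INR r - 1) ^ (r - 1)) <= (3 / 4) ^ (r - 2).
Proof.
case: r => [|[|m]] // _.
have -> : (m.+2 - 1 = m.+1)%nat by lia.
have -> : (m.+2 - 2 = m)%nat by lia.
have -> : INR m.+2 - 1 = INR m.+1 by rewrite S_INR; ring.
have := INR_leq (fact_le_geometric m); move: ((m.+2)`!)%nat => f.
rewrite !INRM !INRX -[INR 2]/(2) -[INR 3]/(2 + 1) (_ : INR 4 = 4); last by rewrite /=; ring.
move=> h; have b0 : 0 < INR m.+1 ^ m.+1 by apply: pow_lt; apply: lt_0_INR; lia.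
have p0 : 0 < 4 ^ m by apply: pow_lt; lra.
rewrite /Rdiv Rpow_mult_distr pow_inv.
apply: (Rmult_le_reg_r (2 * INR m.+1 ^ m.+1 * 4 ^ m)); first by nra.
have -> : INR f * / (2 * INR m.+1 ^ m.+1) * (2 * INR m.+1 ^ m.+1 * 4 ^ m) =
  INR f * 4 ^ m by field; lra.
apply: Rle_trans h _; right.
by rewrite (_ : 2 + 1 = 3); [field; lra | ring].
Qed.

Lemma Rpower_div_pow (x y : R) (r : nat) : (0 < r)%nat ->
  Rpower x (y / INR r) ^ r = Rpower x y.
Proof.
move=> r0; have r0R : INR r <> 0 by apply: not_0_INR; lia.
by rewrite /Rpower exp_pow_INR; congr exp; field.
Qed.

Lemma qprime_pow (r : nat) : (2 <= r)%nat ->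
  qprime r ^ r = INR r * (INR (r`!)%nat / (2 * (INR r - 1) ^ (r - 1))).
Proof.
move=> r2; have r0 : (0 < r)%nat by lia.
have rR : 2 <= INR r by have := INR_leq r2; rewrite /=; lra.
have f0 : 0 < INR (r`!)%nat by apply: lt_0_INR; apply/ssrnat.ltP; apply: fact_gt0.
have i1 : 0 < 1 - 1 / INR r.
  have -> : 1 - 1 / INR r = (INR r - 1) * / INR r by field; lra.
  by apply: Rmult_lt_0_compat; [lra | apply: Rinv_0_lt_compat; lra].
rewrite /qprime /Rdiv !Rpow_mult_distr pow_inv !Rpow_mult_distr.
rewrite -![_ * / INR r]/(_ / INR r) !Rpower_div_pow // !Rpower_1 //; try lra.
have -> : INR r - 1 = INR (r - 1) by rewrite INRB //; lia.
have -> : INR r - 2 = INR (r - 2) by rewrite INRB.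
rewrite !Rpower_pow //; last lra.
have -> : (1 - 1 / INR r) = INR (r - 1) / INR r.
  by rewrite (INRB r0) /=; field; lra.
rewrite /Rdiv Rpow_mult_distr pow_inv.
case: (r) r2 rR f0 {i1} => [|[|m]] // _ rR f0.
have -> : (m.+2 - 1 = m.+1)%nat by lia.
have -> : (m.+2 - 2 = m)%nat by lia.
rewrite -[INR m.+2 ^ m.+1]/(INR m.+2 * INR m.+2 ^ m).
field; repeat split; try (apply: pow_nonzero); try lra.
by apply: not_0_INR; lia.
Qed.

Lemma qprime_gt0 (r : nat) : 0 < qprime r.
Proof.
by apply: Rdiv_lt_0_compat; repeat apply: Rmult_lt_0_compat; apply: exp_pos.
Qed.

Lemma pow_le_of_le1 (x : R) (i j : nat) : 0 <= x <= 1 -> (i <= j)%nat -> x ^ j <= x ^ i.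
Proof.
move=> [x0 x1] ij; rewrite -(subnK ij) -plusE pow_add.
have := pow_le x i x0; have := pow_incr x 1 (j - i) (conj x0 x1); rewrite pow1.
have := pow_le x (j - i) x0; nra.
Qed.

(** Follows from q'(r)^r <= r and (1 - eps)^r <= 1 - eps. *)
Lemma last_term_le (r : nat) (lam eps : R) : (2 <= r)%nat -> 0 < eps < 1 ->
  0 <= lam <= (1 - eps) * qprime r -> lam ^ r / INR r <= 1 - eps.
Proof.
move=> r2 heps [lam0 hlam].
have rR : 2 <= INR r by have := INR_leq r2; rewrite /=; lra.
apply: (Rmult_le_reg_r (INR r)); first lra.
have -> : lam ^ r / INR r * INR r = lam ^ r by field; lra.
apply: Rle_trans (pow_incr _ _ r (conj lam0 hlam)) _.
rewrite Rpow_mult_distr qprime_pow //.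
have e1 : (1 - eps) ^ r <= 1 - eps.
  have h : 0 <= 1 - eps <= 1 by lra.
  by have := @pow_le_of_le1 (1 - eps) 1 r h; rewrite pow_1; apply; lia.
have e0 : 0 <= (1 - eps) ^ r by apply: pow_le; lra.
have q1 : INR (r`!)%nat / (2 * (INR r - 1) ^ (r - 1)) <= 1.
  apply: Rle_trans (fact_ratio_le r2) _.
  by have := pow_incr (3 / 4) 1 (r - 2); rewrite pow1; apply; lra.
have := Rmult_le_compat_l _ _ _ e0 q1; nra.
Qed.

(** Carries a bound on the r-th power over to all lower powers with the same constant. *)
Lemma pow_root_le (x c : R) (j r : nat) : 0 <= x -> 1 <= c -> (j <= r)%nat ->
  x ^ r <= c -> x ^ j <= c.
Proof.
move=> x0 c1 jr h; case: (Rle_lt_dec x 1) => x1.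
  by apply: Rle_trans c1; rewrite -(pow1 j); apply: pow_incr.
by apply: Rle_trans h; apply: Rle_pow; [lra | apply/ssrnat.leP].
Qed.

Lemma lam_pow_le (r j : nat) (lam : R) : (2 <= r)%nat -> (j <= r)%nat ->
  0 <= lam <= qprime r -> lam ^ j <= 10 * (361 / 400) ^ j.
Proof.
move=> r2 jr [lam0 hlam].
have p0 : 0 < (361 / 400) ^ j by apply: pow_lt; lra.
have -> : lam ^ j = (lam / (361 / 400)) ^ j * (361 / 400) ^ j.
  by rewrite -Rpow_mult_distr; congr pow; field.
apply: Rmult_le_compat_r; first lra.
have x0 : 0 <= lam / (361 / 400) by lra.
apply: (pow_root_le x0 _ jr); first lra.
have -> : (lam / (361 / 400)) ^ r = lam ^ r * / (361 / 400) ^ r.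
  by rewrite -pow_inv -Rpow_mult_distr.
have p0' : 0 < (361 / 400) ^ r by apply: pow_lt; lra.
apply: (Rmult_le_reg_r ((361 / 400) ^ r)) => //.
have -> : lam ^ r * / (361 / 400) ^ r * (361 / 400) ^ r = lam ^ r by field; lra.
apply: Rle_trans (pow_incr _ _ r (conj lam0 hlam)) _.
rewrite qprime_pow //.
have rR : 2 <= INR r by have := INR_leq r2; rewrite /=; lra.
apply: Rle_trans (Rmult_le_compat_l _ _ _ _ (fact_ratio_le r2)) _; first lra.
case: (r) r2 rR {jr x0 p0' hlam} => [|[|m]] // _ rR.
have -> : (m.+2 - 2 = m)%nat by lia.
rewrite -[(361 / 400) ^ m.+2]/(361 / 400 * (361 / 400 * (361 / 400) ^ m)).
(* The excess of the rate over 3/4 absorbs the linear factor r = m + 2, by Bernoulli for (1 +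
   61/300)^m. *)
have -> : 361 / 400 = 3 / 4 * (1 + 61 / 300) by field.
rewrite Rpow_mult_distr.
have B := @poly m (61 / 300); have {}B := B ltac:(lra).
have q0 : 0 < (3 / 4) ^ m by apply: pow_lt; lra.
have m0 := pos_INR m.
move: B q0; rewrite !S_INR; move: ((3 / 4) ^ m) ((1 + 61 / 300) ^ m) => q b B q0.
apply: (Rle_trans _ (q * (10 * (3 / 4 * (1 + 61 / 300)) ^ 2 * b))); last by right; ring.
rewrite Rmult_comm; apply: Rmult_le_compat_l; first lra.
lra.
Qed.

(** [361 / 400 = (19 / 20) ^ 2]: one factor [19 / 20] keeps the sum over [k]
geometric, the other one makes the terms with [K <= k.+1] small.  In the remaining
terms [r <= K * (r - k.+1)], hence the exponential is at most [exp (- (l / K))]. *)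
Lemma inner_term_le (r k K : nat) (lam l : R) :
  (k.+1 < r)%nat -> (0 < K)%nat -> 0 <= l -> 0 <= lam <= qprime r ->
  INR (r - k) / INR r * lam ^ k.+1 * exp (- (l * (INR (r - k.+1) / INR r))) <=
  10 * (exp (- (l / INR K)) + (19 / 20) ^ K) * (19 / 20) ^ k.+1.
Proof.
move=> kr K0 l0 hlam.
have r2 : (2 <= r)%nat by lia.
have rR : 2 <= INR r by have := INR_leq r2; rewrite /=; lra.
have KR : 1 <= INR K by have := INR_leq K0; rewrite /=; lra.
set s := INR (r - k.+1) / INR r.
have s0 : 0 <= s by apply: Rle_mult_inv_pos; [apply: pos_INR | lra].
have lamj : 0 <= lam ^ k.+1 by apply: pow_le; lra.
have := @lam_pow_le r k.+1 lam r2 (ltnW kr) hlam.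
have -> : 361 / 400 = 19 / 20 * (19 / 20) by field.
rewrite Rpow_mult_distr; set t := (19 / 20) ^ k.+1 => hj.
have t0 : 0 < t by apply: pow_lt; lra.
have t1 : t <= 1 by have := pow_incr (19 / 20) 1 k.+1; rewrite pow1; apply; lra.
have w1 : INR (r - k) / INR r <= 1.
  apply: (Rmult_le_reg_r (INR r)); first lra.
  have -> : INR (r - k) / INR r * INR r = INR (r - k) by field; lra.
  by rewrite Rmult_1_l; apply: INR_leq; lia.
have e0 := exp_pos (- (l * s)).
have d0 := exp_pos (- (l / INR K)).
have T0 : 0 < (19 / 20) ^ K by apply: pow_lt; lra.
apply: (Rle_trans _ (lam ^ k.+1 * exp (- (l * s)))).
  have : 0 <= lam ^ k.+1 * exp (- (l * s)) by apply: Rmult_le_pos; lra.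
  rewrite Rmult_assoc; nra.
apply: (Rle_trans _ (10 * (t * t) * exp (- (l * s)))).
  by apply: Rmult_le_compat_r; lra.
case: (leqP r (K * (r - k.+1))) => [big | small].
  have hs : / INR K <= s.
    apply: (Rmult_le_reg_r (INR K * INR r)); first nra.
    have -> : / INR K * (INR K * INR r) = INR r by field; lra.
    have -> : s * (INR K * INR r) = INR K * INR (r - k.+1) by rewrite /s; field; lra.
    by rewrite -INRM; apply: INR_leq.
  have : exp (- (l * s)) <= exp (- (l / INR K)).
    by apply: exp_nondecreasing; rewrite /Rdiv; nra.
  move=> h; apply: (Rle_trans _ (10 * exp (- (l / INR K)) * t)); last by nra.
  have : 10 * (t * t) <= 10 * t by nra.
  nra.
have e1 : exp (- (l * s)) <= 1 by rewrite -exp_0; apply: exp_nondecreasing; nra.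
(* Otherwise, with d = r - (k+1) >= 1, one has K d >= (k+2) d >= (k+1) + d = r, against [small]. *)
have Kk : (K <= k.+1)%nat by nia.
have : t <= (19 / 20) ^ K by apply: pow_le_of_le1 => //; lra.
move=> h; apply: (Rle_trans _ (10 * (t * t))); first by nra.
nra.
Qed.

(** * Colourability and the choice of the threshold *)

Lemma chain_union_bound_geometric (V : finType) (E : {set {set V}})
    (n r M : nat) (D eta rho beta Y c d t : R) :
  uniform n E -> (2 <= n)%nat -> 0 <= D -> 0 <= eta ->
  INR r.+1 * D + INR r * INR M * eta = 1 ->
  (forall m : nat, D + INR m * eta <= rho * beta ^ m) -> D + INR M * eta <= Y ->
  ~ colorable r.+1 E -> 0 <= c -> 0 <= t < 1 ->
  (forall k, (k < r)%nat -> INR (r.+1 - k) * INR #|E| ^ k.+1 *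
     (Y ^ 2 * (INR M * eta) ^ k * (rho ^ k.+1 * beta ^ (k * M.+1)) ^ (n - 2)) <= c * t ^ k) ->
  INR (r.+1 - r) * INR #|E| ^ r.+1 *
     (Y ^ 2 * (INR M * eta) ^ r * (rho ^ r.+1 * beta ^ (r * M.+1)) ^ (n - 2)) <= d ->
  1 <= c / (1 - t) + d.
Proof.
move=> unif n2 D0 eta0 tot Hexp HY ncol c0 [t0 t1] Hk Hr.
apply/RleP.
have := @chain_union_bound _ V E n r M D eta rho beta Y unif n2 _ _ _ _ _ ncol.
move=> H; apply: (Order.POrderTheory.le_trans (H _ _ _ _ _)).
- exact/RleP.
- exact/RleP.
- by rewrite GRing.natrM -!INRE.
- by move=> m; apply/RleP; rewrite -INRE -RpowE; apply: Hexp.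
- by apply/RleP; rewrite -INRE.
have := @sum_geometric_last_le _ (fun k => INR (r.+1 - k) * INR #|E| ^ k.+1 *
     (Y ^ 2 * (INR M * eta) ^ k * (rho ^ k.+1 * beta ^ (k * M.+1)) ^ (n - 2))) r c d t.
move=> H2; rewrite (eq_bigr (fun k : 'I_r.+1 => INR (r.+1 - k) * INR #|E| ^ k.+1 *
     (Y ^ 2 * (INR M * eta) ^ k * (rho ^ k.+1 * beta ^ (k * M.+1)) ^ (n - 2)))); last first.
  by move=> k _; rewrite !INRE !RpowE.
apply: H2.
- exact/RleP.
- by apply/andP; split; [apply/RleP | apply/RltP].
- by move=> k kr; apply/RleP; rewrite -RpowE; apply: Hk.
- exact/RleP.
Qed.

(** The estimate at a fixed n, with l = ln ln n. The constant 190 is 10 (19/20) / (1 - 19/20), the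
    sum of the geometric bounds for k < r - 1. *)
Lemma colorable_of_few_edges (n r K : nat) (eps l : R) (V : finType) (E : {set {set V}}) :
  (2 <= n)%nat -> (2 <= r)%nat -> (0 < K)%nat -> 0 < eps < 1 -> 0 <= l ->
  INR n = exp (exp l) -> uniform n E ->
  INR #|E| <= (1 - eps) * qprime r * INR r ^ (n - 1) *
              exp ((1 - 1 / INR r) * (exp l - l)) ->
  exp (5 * (exp l / INR n)) *
    (190 * (exp (- (l / INR K)) + (19 / 20) ^ K) + (1 - eps)) < 1 ->
  colorable r E.
Proof.
move=> n2 r2 K0 heps l0 en unif hE hlt; apply: contrapT => ncol.
have nR : 2 <= INR n by have := INR_leq n2; rewrite /=; lra.
have rR : 2 <= INR r by have := INR_leq r2; rewrite /=; lra.
have L0 := exp_pos l.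
have Ln : exp l <= INR n by rewrite en; have := exp_ineq1_le (exp l); lra.
set L := exp l in L0 Ln hE hlt en *.
set X := INR r ^ (n - 1) * exp ((1 - 1 / INR r) * (L - l)).
have X0 : 0 < X by apply: Rmult_lt_0_compat; [apply: pow_lt; lra | apply: exp_pos].
pose lam := INR #|E| / X.
have lam0 : 0 <= lam by apply: Rle_mult_inv_pos; [apply: pos_INR |].
have eE : INR #|E| = lam * INR r ^ (n - 1) * exp ((1 - 1 / INR r) * (L - l)).
  by rewrite Rmult_assoc -/X /lam; field; lra.
have lamq : lam <= (1 - eps) * qprime r.
  apply: (Rmult_le_reg_r X) => //.
  have -> : lam * X = INR #|E| by rewrite /lam; field; lra.
  by rewrite /X -Rmult_assoc.
have q0 := qprime_gt0 r.
have lamq' : 0 <= lam <= qprime r by nra.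
pose M := (n * r)%nat.
have MR : INR M = INR n * INR r by rewrite INRM.
(* The M + 1 steps of size [eta] make up the gap length ln n / (r n). *)
pose eta := L / INR n / INR r / (INR M + 1).
have M1 : 0 < INR M + 1 by rewrite MR; nra.
have u0 : 0 <= L / INR n by apply: Rle_mult_inv_pos; lra.
have u1 : L / INR n <= 1.
  apply: (Rmult_le_reg_r (INR n)); first lra.
  have -> : L / INR n * INR n = L by field; lra.
  lra.
have ur0 : 0 <= L / INR n / INR r by apply: Rle_mult_inv_pos; lra.
have eeta : eta * (INR M + 1) = L / INR n / INR r by rewrite /eta; field; lra.
have eta0 : 0 <= eta by apply: Rle_mult_inv_pos.
have Meta : INR M * eta <= L / INR n / INR r by lra.
have Meta0 : 0 <= INR M * eta by apply: Rmult_le_pos => //; apply: pos_INR.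
have rB : INR (r - 1) = INR r - 1 by rewrite INRB //; lia.
pose D := (1 - INR (r - 1) * INR M * eta) / INR r.
have eD : INR r * D + INR (r - 1) * INR M * eta = 1 by rewrite /D; field; lra.
have eu : INR r * (L / INR n / INR r) = L / INR n by field; lra.
have D0 : 0 <= D.
  by apply: Rle_mult_inv_pos; [rewrite rB; nra | lra].
have D1 : INR r * D <= 1.
  have : 0 <= INR (r - 1) * (INR M * eta) by apply: Rmult_le_pos => //; apply: pos_INR.
  lra.
(* Write D + m eta = (1 + (r D - 1) + m r eta) / r and use 1 + x <= exp x. *)
have Hexp m : D + INR m * eta <= exp (INR r * D - 1) / INR r * exp (INR r * eta) ^ m.
  rewrite exp_pow_INR /Rdiv Rmult_assoc (Rmult_comm (/ _)) -Rmult_assoc -exp_plus.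
  apply: (Rmult_le_reg_r (INR r)); first lra.
  rewrite Rmult_assoc Rinv_l; last lra.
  rewrite Rmult_1_r; apply: Rle_trans (exp_ineq1_le _); right; ring.
have HY : D + INR M * eta <= exp (L / INR n) / INR r.
  apply: (Rmult_le_reg_r (INR r)); first lra.
  rewrite /Rdiv Rmult_assoc Rinv_l; last lra.
  by rewrite Rmult_1_r; apply: Rle_trans (exp_ineq1_le _); nra.
set C := exp (5 * (L / INR n)) in hlt.
have C0 : 0 < C by apply: exp_pos.
set dl := exp (- (l / INR K)) + (19 / 20) ^ K in hlt.
have dl0 : 0 <= dl.
  by apply: Rplus_le_le_0_compat; [apply: Rlt_le; apply: exp_pos | apply: pow_le; lra].
(* The union bound counts r + 1 colours, so r is replaced by its successor. *)
case: r r2 rR ncol hE @X X0 @lam lam0 eE lamq q0 lamq' @M MR @eta M1 ur0 eeta eta0 Meta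
  Meta0 rB @D eD eu D0 D1 Hexp HY => [//|r] r2 rR ncol hE X X0 lam lam0 eE lamq q0 lamq' M MR
  eta M1 ur0 eeta eta0 Meta Meta0 rB D eD eu D0 D1 Hexp HY.
have er : (r.+1 - 1 = r)%nat by lia.
have tot : INR r.+1 * D + INR r * INR M * eta = 1 by rewrite -[in INR r * _]er.
have term k : (k < r.+1)%nat -> _ :=
  fun kr => @chain_term_le n r.+1 k M L l lam eta D n2 r2 kr lam0 (Rlt_le _ _ L0)
    erefl en erefl eeta eD.
have := @chain_union_bound_geometric V E n r M D eta _ _ _
  (C * (10 * dl * (19 / 20))) (C * (1 - eps)) (19 / 20)
  unif n2 D0 eta0 tot Hexp HY ncol.
move=> H; suff : 1 <= C * (10 * dl * (19 / 20)) / (1 - 19 / 20) + C * (1 - eps).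
  move: hlt; move: C dl {H term C0 dl0} => C dl; lra.
apply: H.
- by apply: Rmult_le_pos; lra.
- lra.
- move=> k kr; rewrite eE; apply: Rle_trans (term k (ltnW kr)) _.
  rewrite [X in _ <= X]Rmult_assoc -/C; apply: Rmult_le_compat_l; first exact: Rlt_le.
  apply: Rle_trans (@inner_term_le r.+1 k K lam l kr K0 l0 lamq') _.
  by right; rewrite -/dl /=; ring.
- rewrite eE; apply: Rle_trans (term r (ltnSn r)) _.
  apply: Rmult_le_compat_l; first exact: Rlt_le.
  rewrite !subnn (_ : (r.+1 - r = 1)%nat); last lia.
  have := @last_term_le r.+1 lam eps r2 heps (conj lam0 lamq).
  rewrite /Rdiv Rmult_0_l Rmult_0_r Ropp_0 exp_0 Rmult_1_r Rmult_1_l Rmult_comm //.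
Qed.

Theorem theorem2 (r : nat -> nat)
  (hr2 : forall n : nat, (2 <= r n)%coq_nat)
  (hro : forall c : R, 0 < c -> exists N : nat, forall n : nat, (N <= n)%coq_nat ->
           INR (r n) <= c * (ln (INR n) / ln (ln (INR n)))) :
  forall eps : R, 0 < eps < 1 ->
  exists n0 : nat, forall n : nat, (n0 <= n)%coq_nat ->
    m_ge n (r n)
      ((1 - eps) * qprime (r n)
       * Rpower (INR n / ln (INR n)) ((INR (r n) - 1) / INR (r n))
       * INR (r n) ^ (n - 1)).
Proof.
move=> eps heps.
(* With both parts of the small term at most eps / 1600, their contribution 190 * 2 * eps / 1600
   stays below eps / 4. *)
have [K0 hK] := pow_lt_1_zero (19 / 20) ltac:(rewrite Rabs_right; lra) (eps / 1600)
  ltac:(lra).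
pose K := K0.+1.
have tauK : (19 / 20) ^ K < eps / 1600.
  have := hK K ltac:(rewrite /K; lia).
  by rewrite Rabs_right //; apply: Rle_ge; apply: pow_le; lra.
have KR : 1 <= INR K by rewrite /K S_INR; have := pos_INR K0; lra.
pose l0 := INR K * ln (1600 / eps).
have big : 1 < 1600 / eps.
  apply: (Rmult_lt_reg_r eps); first lra.
  by have -> : 1600 / eps * eps = 1600 by [field; lra]; lra.
have l00 : 0 <= l0.
  apply: Rmult_le_pos; first lra.
  by rewrite -ln_1; apply: Rlt_le; apply: ln_increasing; lra.
(* The summands ensure in turn ln ln n >= l0, 5 ln n / n <= eps / 4, and n > 2. *)
pose B := exp (exp l0) + (40 / eps) ^ 2 + 2.
have [n0 hn0] := INR_unbounded B.
exists n0 => n n0n V E unif ncol.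
have nB : B < INR n by apply: Rlt_le_trans hn0 _; apply: le_INR.
have sq0 : 0 <= (40 / eps) ^ 2 by apply: pow2_ge_0.
have n2R : 2 < INR n by have := exp_pos (exp l0); rewrite /B in nB; lra.
have n2 : (2 <= n)%nat by apply/ssrnat.leP; apply: INR_le; rewrite /=; lra.
set L := ln (INR n).
have eL : INR n = exp L by rewrite exp_ln; lra.
have LL0 : exp l0 < L.
  by apply: exp_lt_inv; rewrite -eL; rewrite /B in nB; lra.
have Lpos : 0 < L by have := exp_pos l0; lra.
pose l := ln L.
have el : L = exp l by rewrite exp_ln.
have ll0 : l0 <= l.
  by apply: Rlt_le; apply: exp_lt_inv; rewrite -el.
have r2 : (2 <= r n)%nat by apply/ssrnat.leP.
have rR : 2 <= INR (r n) by have := INR_leq r2; rewrite /=; lra.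
apply: Rnot_lt_le => hE; apply: ncol.
have key1 : 5 * (L / INR n) <= eps / 4.
  have s0 : 0 < sqrt (INR n) by apply: sqrt_lt_R0; lra.
  have ss : sqrt (INR n) * sqrt (INR n) = INR n by apply: sqrt_sqrt; lra.
  (* Here ln n = 2 ln (sqrt n), and ln x <= x. *)
  have Ls : L <= 2 * sqrt (INR n).
    rewrite /L -{1}ss ln_mult //.
    have := exp_ineq1_le (ln (sqrt (INR n))); rewrite exp_ln //; lra.
  have s40 : 40 / eps <= sqrt (INR n).
    rewrite -(sqrt_pow2 (40 / eps)); last by apply: Rle_mult_inv_pos; lra.
    by apply: sqrt_le_1_alt; have := exp_pos (exp l0); rewrite /B in nB; lra.
  have se : 40 <= eps * sqrt (INR n).
    have : eps * (40 / eps) <= eps * sqrt (INR n) by apply: Rmult_le_compat_l; lra.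
    by have -> : eps * (40 / eps) = 40 by field; lra.
  apply: (Rmult_le_reg_r (INR n)); first lra.
  have -> : 5 * (L / INR n) * INR n = 5 * L by field; lra.
  rewrite -ss; nra.
apply: (@colorable_of_few_edges n (r n) K eps l V E n2 r2 _ heps _ _ unif) => //.
- lra.
- by rewrite -el.
- apply: Rlt_le; apply: Rlt_le_trans hE _; right; rewrite -el -/L.
  have -> : Rpower (INR n / L) ((INR (r n) - 1) / INR (r n)) =
    exp ((1 - 1 / INR (r n)) * (L - l)).
    rewrite /Rpower /Rdiv ln_mult; [|lra|exact: Rinv_0_lt_compat].
    by rewrite ln_Rinv // -/L -/l; congr exp; field; lra.
  ring.
rewrite -el.
have e1 : exp (- (l / INR K)) <= eps / 1600.
  have -> : eps / 1600 = exp (- ln (1600 / eps)).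
    by rewrite exp_Ropp exp_ln; [field; lra | lra].
  apply: exp_nondecreasing; apply: Ropp_le_contravar.
  apply: (Rmult_le_reg_r (INR K)); first lra.
  have -> : l / INR K * INR K = l by field; lra.
  by rewrite Rmult_comm.
(* After division by the exponential it suffices that the bracket, below 1 - eps + eps / 4, is less
   than 1 - eps / 4 <= exp (- 5 L / n). *)
have e2 := exp_ineq1_le (- (5 * (L / INR n))).
have e3 : exp (5 * (L / INR n)) * exp (- (5 * (L / INR n))) = 1.
  by rewrite -exp_plus Rplus_opp_r exp_0.
have e4 := exp_pos (5 * (L / INR n)).
rewrite -[X in _ < X]e3; apply: Rmult_lt_compat_l => //; lra.
Qed.
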